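(* Let $S$ be a numerical monoid properly contained in $\mathbb N$. Then $$\mathrm{Aut}\bigl(\mathrm{Hom}_{\mathbf{Kl}(\mathscr P_{\mathrm{fin}})}(\mathbb Z/2\mathbb Z,S)\bigr)\cong\{1\},$$ where the Kleisli Hom-space is a monoid under convolution.
   Context: A numerical monoid is an additive submonoid $S$ of $\mathbb N=\{0,1,2,\ldots\}$ with $\mathbb N\setminus S$ finite; it is regarded as a pointed set with basepoint $0$. $\mathscr P_{\mathrm{fin}}$ is the reduced finite powerset monad on the category of pointed sets: it sends $(X,* )$ to the set of finite subsets $A\subseteq X$ with $*\in A$, pointed by $\{*\}$, acts on morphisms by direct image, with unit $x\mapsto\{x,*\}$ and multiplication given by union. A morphism $X\rightsquigarrow Y$ in its Kleisli category $\mathbf{Kl}(\mathscr P_{\mathrm{fin}})$ is a basepoint-preserving map from $X$ to the value of the monad at $Y$. Put $\mathcal P_{\mathrm{fin},0}(S)=\{A\subseteq S:A\text{ finite},\ 0\in A\}$, with $A\star B=\{a+b:a\in A,b\in B\}$. $\mathbb Z/2\mathbb Z$ denotes the set $\{0,1\}$ pointed by $0$, so an element of $\mathrm{Hom}_{\mathbf{Kl}(\mathscr P_{\mathrm{fin}})}(\mathbb Z/2\mathbb Z,S)$ is a map $u:\{0,1\}\to\mathcal P_{\mathrm{fin},0}(S)$ with $u(0)=\{0\}$. Convolution is $(u\star v)(i)=u(i)\star v(i)$, with identity the map constantly equal to $\{0\}$. $\mathrm{Aut}$ denotes the automorphism group of this monoid. *)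

(* Defs.v *)
From HB Require Import structures.
From mathcomp Require Import all_boot all_algebra finmap.
From mathcomp Require Import boolp classical_sets cardinality.

Set Implicit Arguments.
Unset Strict Implicit.
Unset Printing Implicit Defensive.

Import GRing.Theory.

Local Open Scope classical_set_scope.
Local Open Scope fset_scope.

Record ptd_map (X Y : pointedType) := PtdMap {
  ptd_fun :> X -> Y;
  ptd_fun_point : ptd_fun point = point }.

Lemma ptd_mapP (X Y : pointedType) (f g : ptd_map X Y) : f =1 g -> f = g.
Proof.
case: f g => [f f0] [g g0] /= /funext fg; case: _ / fg in g0 *.
by congr PtdMap; exact: Prop_irrelevance.
Qed.

HB.instance Definition _ (X Y : pointedType) := gen_eqMixin (ptd_map X Y).
HB.instance Definition _ (X Y : pointedType) := gen_choiceMixin (ptd_map X Y).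

Definition ptd_comp (X Y Z : pointedType) (g : ptd_map Y Z) (f : ptd_map X Y) :
    ptd_map X Z :=
  @PtdMap X Z (g \o f)
    (eq_trans (congr1 g (ptd_fun_point f)) (ptd_fun_point g)).

Record Pfin (X : pointedType) := PFin {
  pfset :> {fset X};
  point_in_pfset : point \in pfset }.

HB.instance Definition _ (X : pointedType) := [isSub for @pfset X].
HB.instance Definition _ (X : pointedType) := [Choice of Pfin X by <:].
HB.instance Definition _ (X : pointedType) :=
  isPointed.Build (Pfin X) (PFin (fset11 point)).

Lemma PfinP (X : pointedType) (A B : Pfin X) :
  (forall x, (x \in pfset A) = (x \in pfset B)) -> A = B.
Proof. by move=> AB; apply: val_inj; apply/fsetP. Qed.

Section Monad.
Variables X Y : pointedType.

Lemma Pfin_map_subproof (f : ptd_map X Y) (A : Pfin X) :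
  point \in [fset f x | x in pfset A].
Proof. by rewrite -(ptd_fun_point f) in_imfset //= point_in_pfset. Qed.

Lemma Pfin_map_point (f : ptd_map X Y) :
  PFin (Pfin_map_subproof f point) = point.
Proof. by apply: val_inj; rewrite /= imfset_fset1 ptd_fun_point. Qed.

Definition Pfin_map (f : ptd_map X Y) : ptd_map (Pfin X) (Pfin Y) :=
  @PtdMap (Pfin X) (Pfin Y) (fun A => PFin (Pfin_map_subproof f A))
    (Pfin_map_point f).

Lemma Pfin_unit_subproof (x : X) : point \in [fset x; point].
Proof. by rewrite !inE eqxx orbT. Qed.

Lemma Pfin_unit_point : PFin (Pfin_unit_subproof point) = point.
Proof. by apply: val_inj; rewrite /= fsetUid. Qed.

Definition Pfin_unit : ptd_map X (Pfin X) :=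
  @PtdMap X (Pfin X) (fun x => PFin (Pfin_unit_subproof x)) Pfin_unit_point.

Lemma Pfin_mult_subproof (AA : Pfin (Pfin X)) :
  point \in \bigcup_(A <- pfset AA) pfset A.
Proof.
by apply/bigfcupP; exists point; rewrite ?point_in_pfset.
Qed.

Lemma Pfin_mult_point : PFin (Pfin_mult_subproof point) = point.
Proof. by apply: val_inj; rewrite /= big_seq_fset1. Qed.

Definition Pfin_mult : ptd_map (Pfin (Pfin X)) (Pfin X) :=
  @PtdMap (Pfin (Pfin X)) (Pfin X) (fun AA => PFin (Pfin_mult_subproof AA))
    Pfin_mult_point.

End Monad.

Definition Kl_hom (X Y : pointedType) := ptd_map X (Pfin Y).
HB.instance Definition _ (X Y : pointedType) := Choice.on (Kl_hom X Y).

Definition Kl_id (X : pointedType) : Kl_hom X X := @Pfin_unit X.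

Definition Kl_comp (X Y Z : pointedType) (g : Kl_hom Y Z) (f : Kl_hom X Y) :
    Kl_hom X Z :=
  ptd_comp (@Pfin_mult Z) (ptd_comp (Pfin_map g) f).

Section KleisliLaws.

Lemma in_Kl_comp (X Y Z : pointedType) (g : Kl_hom Y Z) (f : Kl_hom X Y) x z :
  reflect (exists2 y, y \in pfset (f x) & z \in pfset (g y))
          (z \in pfset (Kl_comp g f x)).
Proof.
apply: (iffP (bigfcupP _ _ _ _)) => [[B /andP[/imfsetP[y /= yf ->] _] zg]|].
  by exists y.
by case=> y yf zg; exists (g y); rewrite // andbT in_imfset.
Qed.

Lemma Kl_comp1f (X Y : pointedType) (f : Kl_hom X Y) :
  Kl_comp (@Kl_id Y) f = f.
Proof.
apply: ptd_mapP => x; apply: PfinP => z; apply/in_Kl_comp/idP.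
  by case=> y yf; rewrite !inE => /orP[]/eqP-> //; exact: point_in_pfset.
by move=> zf; exists z; rewrite // !inE eqxx.
Qed.

Lemma Kl_compf1 (X Y : pointedType) (f : Kl_hom X Y) :
  Kl_comp f (@Kl_id X) = f.
Proof.
apply: ptd_mapP => x; apply: PfinP => z; apply/in_Kl_comp/idP.
  case=> y; rewrite !inE => /orP[]/eqP-> //.
  by rewrite ptd_fun_point inE => /eqP->; exact: point_in_pfset.
by move=> zf; exists x; rewrite // !inE eqxx.
Qed.

Lemma Kl_compA (X Y Z W : pointedType)
    (h : Kl_hom Z W) (g : Kl_hom Y Z) (f : Kl_hom X Y) :
  Kl_comp h (Kl_comp g f) = Kl_comp (Kl_comp h g) f.
Proof.
apply: ptd_mapP => x; apply: PfinP => w; apply/in_Kl_comp/in_Kl_comp.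
  by case=> z /in_Kl_comp[y yf zg] wh; exists y => //; apply/in_Kl_comp; exists z.
by case=> y yf /in_Kl_comp[z zg wh]; exists z => //; apply/in_Kl_comp; exists y.
Qed.

End KleisliLaws.

Record numerical_monoid := NumericalMonoid {
  nm_set :> set nat;
  nm_set0 : nm_set 0%N;
  nm_setD : forall a b, nm_set a -> nm_set b -> nm_set (a + b)%N;
  nm_cofinite : finite_set (~` nm_set) }.

Definition nm_sort (S : numerical_monoid) : Type := {x : nat | x \in nm_set S}.
Coercion nm_sort : numerical_monoid >-> Sortclass.

HB.instance Definition _ (S : numerical_monoid) := SubChoice.on (nm_sort S).

Section NumericalMonoid.
Variable S : numerical_monoid.

Lemma nm_addr_closed : Algebra.nmod_closed (fun x => x \in nm_set S).
Proof.
split=> [|a b]; rewrite !inE; first exact: nm_set0.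
exact: nm_setD.
Qed.

HB.instance Definition _ :=
  GRing.SubChoice_isSubNmodule.Build nat (fun x => x \in nm_set S) (nm_sort S)
    nm_addr_closed.
HB.instance Definition _ := isPointed.Build (nm_sort S) 0%R.

End NumericalMonoid.

Section PowerMonoid.
Variable S : numerical_monoid.
Implicit Types A B C : Pfin (nm_sort S).

Lemma Pfin_star_subproof A B :
  point \in [fset (a + b)%R | a in pfset A, b in pfset B].
Proof.
apply/imfset2P; exists point; first exact: point_in_pfset.
by exists point; [exact: point_in_pfset | rewrite [RHS]addr0].
Qed.

Definition Pfin_star A B : Pfin (nm_sort S) := PFin (Pfin_star_subproof A B).

Lemma in_Pfin_star A B x :
  reflect (exists a b, [/\ a \in pfset A, b \in pfset B & x = (a + b)%R])
          (x \in pfset (Pfin_star A B)).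
Proof.
apply: (iffP idP) => [/imfset2P[a aA [b bB ->]]|[a [b [aA bB ->]]]].
  by exists a, b.
by apply/imfset2P; exists a => //; exists b.
Qed.

Lemma Pfin_starA : associative Pfin_star.
Proof.
move=> A B C; apply: PfinP => x; apply/in_Pfin_star/in_Pfin_star.
  move=> [a [_ [aA /in_Pfin_star[b [c [bB cC ->]]] ->]]].
  by exists (a + b)%R, c; rewrite addrA; split=> //; apply/in_Pfin_star; exists a, b.
move=> [_ [c [/in_Pfin_star[a [b [aA bB ->]]] cC ->]]].
by exists a, (b + c)%R; rewrite addrA; split=> //; apply/in_Pfin_star; exists b, c.
Qed.

Lemma Pfin_star0s : left_id point Pfin_star.
Proof.
move=> A; apply: PfinP => x; apply/in_Pfin_star/idP.
  by move=> [a [b [/fset1P-> bA ->]]]; rewrite add0r.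
by move=> xA; exists 0%R, x; rewrite add0r; split=> //; exact/fset1P.
Qed.

Lemma Pfin_stars0 : right_id point Pfin_star.
Proof.
move=> A; apply: PfinP => x; apply/in_Pfin_star/idP.
  by move=> [a [b [aA /fset1P-> ->]]]; rewrite addr0.
by move=> xA; exists x, 0%R; rewrite addr0; split=> //; exact/fset1P.
Qed.

HB.instance Definition _ :=
  isMonoid.Build (Pfin (nm_sort S)) Pfin_starA Pfin_star0s Pfin_stars0.

Variable X : pointedType.
Implicit Types u v w : Kl_hom X (nm_sort S).

Lemma Kl_conv_point u v : Pfin_star (u point) (v point) = point.
Proof. by rewrite !ptd_fun_point Pfin_star0s. Qed.

Definition Kl_conv u v : Kl_hom X (nm_sort S) :=
  @PtdMap X (Pfin (nm_sort S)) (fun i => Pfin_star (u i) (v i))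
    (Kl_conv_point u v).

Definition Kl_conv1 : Kl_hom X (nm_sort S) :=
  @PtdMap X (Pfin (nm_sort S)) (fun=> point) erefl.

Lemma Kl_convA : associative Kl_conv.
Proof. by move=> u v w; apply: ptd_mapP => i; exact: Pfin_starA. Qed.

Lemma Kl_conv1u : left_id Kl_conv1 Kl_conv.
Proof. by move=> u; apply: ptd_mapP => i; exact: Pfin_star0s. Qed.

Lemma Kl_convu1 : right_id Kl_conv1 Kl_conv.
Proof. by move=> u; apply: ptd_mapP => i; exact: Pfin_stars0. Qed.

HB.instance Definition _ :=
  isMonoid.Build (Kl_hom X (nm_sort S)) Kl_convA Kl_conv1u Kl_convu1.

End PowerMonoid.

(* The pointed set Z/2Z is 'Z_2, which unfolds to 'I_2. *)
HB.instance Definition _ (n : nat) := isPointed.Build 'I_n.+1 ord0.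

(* The inverse is stored as data; it is determined by aut_fun, see Aut_monoidP. *)
Record Aut_monoid (M : monoidType) := AutMonoid {
  aut_fun :> M -> M;
  aut_inv : M -> M;
  aut_morphism : monoid.monoid_morphism aut_fun;
  aut_funK : cancel aut_fun aut_inv;
  aut_invK : cancel aut_inv aut_fun }.

HB.instance Definition _ (M : monoidType) := gen_eqMixin (Aut_monoid M).
HB.instance Definition _ (M : monoidType) := gen_choiceMixin (Aut_monoid M).

Section AutGroup.
Variable M : monoidType.
Implicit Types f g h : Aut_monoid M.

Lemma Aut_monoidP f g : f =1 g -> f = g.
Proof.
case: f g => [f f' fM fK f'K] [g g' gM gK g'K] /= /funext fg.
case: _ / fg in gM gK g'K *.
have /funext fg' : f' =1 g' by move=> x; rewrite -[in RHS](f'K x) gK.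
by case: _ / fg' in gK g'K *; congr AutMonoid; exact: Prop_irrelevance.
Qed.

Lemma Aut_one_subproof : monoid.monoid_morphism (@idfun M).
Proof. by []. Qed.

Definition Aut_one : Aut_monoid M :=
  AutMonoid Aut_one_subproof (fun=> erefl) (fun=> erefl).

Lemma Aut_mul_subproof f g : monoid.monoid_morphism (f \o g).
Proof.
case: (aut_morphism f) (aut_morphism g) => [f1 fM] [g1 gM].
by split=> [|x y] /=; rewrite ?g1 ?gM.
Qed.

Definition Aut_mul f g : Aut_monoid M :=
  AutMonoid (Aut_mul_subproof f g)
    (can_comp (aut_funK f) (aut_funK g)) (can_comp (aut_invK g) (aut_invK f)).

Lemma Aut_inv_subproof f : monoid.monoid_morphism (aut_inv f).
Proof.
case: (aut_morphism f) => [f1 fM].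
split=> [|x y]; apply: (can_inj (aut_funK f)).
  by rewrite aut_invK f1.
by rewrite fM !aut_invK.
Qed.

Definition Aut_inv f : Aut_monoid M :=
  AutMonoid (Aut_inv_subproof f) (aut_invK f) (aut_funK f).

Lemma Aut_mulA : associative Aut_mul.
Proof. by move=> f g h; exact: Aut_monoidP. Qed.
Lemma Aut_mul1f : left_id Aut_one Aut_mul.
Proof. by move=> f; exact: Aut_monoidP. Qed.
Lemma Aut_mulf1 : right_id Aut_one Aut_mul.
Proof. by move=> f; exact: Aut_monoidP. Qed.
Lemma Aut_mulVf : left_inverse Aut_one Aut_inv Aut_mul.
Proof. by move=> f; apply: Aut_monoidP => x; exact: aut_funK. Qed.
Lemma Aut_mulfV : right_inverse Aut_one Aut_inv Aut_mul.
Proof. by move=> f; apply: Aut_monoidP => x; exact: aut_invK. Qed.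

HB.instance Definition _ :=
  isGroup.Build (Aut_monoid M) Aut_mulA Aut_mul1f Aut_mulf1 Aut_mulVf Aut_mulfV.

End AutGroup.

Definition group_isomorphic (G H : groupType) :=
  exists f : {multiplicative G -> H}, bijective f.

Definition unit_mul (_ _ : unit) := tt.
Definition unit_inv (_ : unit) := tt.
Lemma unit_mulA : associative unit_mul. Proof. by []. Qed.
Lemma unit_mul1x : left_id tt unit_mul. Proof. by case. Qed.
Lemma unit_mulx1 : right_id tt unit_mul. Proof. by case. Qed.
Lemma unit_mulVx : left_inverse tt unit_inv unit_mul. Proof. by []. Qed.
Lemma unit_mulxV : right_inverse tt unit_inv unit_mul. Proof. by []. Qed.

HB.instance Definition _ :=
  isGroup.Build unit unit_mulA unit_mul1x unit_mulx1 unit_mulVx unit_mulxV.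

(* Main.v *)
Require Import Defs.
From mathcomp Require Import all_boot all_algebra finmap.
From mathcomp Require Import boolp classical_sets cardinality.
From mathcomp Require Import zify.

(** Evaluation at the nontrivial point identifies the Hom-monoid with the reduced
    power monoid P of S, so let f be an automorphism of P.

    For A in P with maximum a one has (k+1)A = kA + {0,a} for some k; hence
    f permutes the sets {0,s}, inducing an automorphism of S, which is trivial.
    Therefore f fixes every {0,s} and preserves maxima.

    For x in S let T_n = {0} together with the elements of S in ]x,n].  Two families
    of relations, T_n + {0,c} = T_(n+c) and T_n + T_m = T_(n+m), force f(T_c) to
    contain T_c for suitable large c as soon as f(T_n) contains n-1 for large n.  The
    latter is where S <> N enters: a sum of sets {0,s} is fixed by f and symmetric,
    so it does not contain its maximum minus 1, because 1 is not in S (this excludes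
    the reversal A |-> max A - A, an automorphism when S = N).  Applied to the inverse
    of f, this shows that f(T_c) has no element in ]0,x].  Finally x belongs to A
    iff A + {0,x} + T_n = A + T_(n+x) for large n, and this passes from A to f(A). *)

Set Implicit Arguments.
Unset Strict Implicit.
Unset Printing Implicit Defensive.

Local Open Scope classical_set_scope.
Local Open Scope group_scope.

(** * Elements of the power monoid as finite sets of naturals, and their maxima *)

Section NaturalElements.
Variable S : numerical_monoid.
Local Notation P := (Pfin (nm_sort S)).
Implicit Types (A B C : P) (s k n m c : nat).

(** Membership moves from the subtype to [nat], where subtraction and [lia] are available. *)
Definition elts A : {fset nat} := [fset val a | a in pfset A]%fset.

Lemma eltsP A B : elts A =i elts B -> A = B.
Proof.
move=> AB; apply: PfinP => x.
have mem C : (x \in pfset C) = (val x \in elts C).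
  by rewrite mem_imfset //; exact: val_inj.
by rewrite !mem AB.
Qed.

Lemma elts0 A : 0 \in elts A.
Proof. by apply/imfsetP; exists point; rewrite //= point_in_pfset. Qed.

Lemma elts_nm A s : s \in elts A -> s \in nm_set S.
Proof. by case/imfsetP => a _ ->; exact: valP. Qed.

Lemma in_elts1 s : (s \in elts 1) = (s == 0).
Proof.
apply/imfsetP/eqP => [[a /= /fset1P-> ->]//|->]; exists point => //.
exact/fset1P.
Qed.

Lemma in_eltsM A B s :
  reflect (exists a b, [/\ a \in elts A, b \in elts B & s = a + b])
          (s \in elts (A * B)).
Proof.
apply: (iffP idP) => [/imfsetP[_ /in_Pfin_star[a [b [aA bB ->]]] ->]|].
  by exists (val a), (val b); split; rewrite ?in_imfset.
move=> [_ [_ [/imfsetP[a /= aA ->] /imfsetP[b /= bB ->] ->]]].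
by apply/imfsetP; exists (a + b)%R => //; apply/in_Pfin_star; exists a, b.
Qed.

Lemma eltsM A B a b : a \in elts A -> b \in elts B -> a + b \in elts (A * B).
Proof. by move=> aA bB; apply/in_eltsM; exists a, b. Qed.

Lemma eltsMl A B a : a \in elts A -> a \in elts (A * B).
Proof. by move=> aA; rewrite -[a]addn0 eltsM ?elts0. Qed.

Lemma eltsMr A B b : b \in elts B -> b \in elts (A * B).
Proof. by move=> bB; rewrite -[b]add0n eltsM ?elts0. Qed.

Definition nm_upto n : seq (nm_sort S) := pmap insub (iota 0 n.+1).

Lemma mem_nm_upto n (x : nm_sort S) : (x \in nm_upto n) = (val x <= n).
Proof. by rewrite mem_pmap_sub mem_iota. Qed.

Lemma cut_subproof (p : pred nat) n :
  point \in (point |` [fset x in nm_upto n | p (val x)])%fset.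
Proof. by rewrite !inE eqxx. Qed.

(* Locked: unification of two different cuts would otherwise unfold them forever. *)
Definition cut : pred nat -> nat -> P :=
  locked (fun p n => PFin (cut_subproof p n)).

Lemma in_cut p n s :
  (s \in elts (cut p n)) = (s == 0) || [&& s \in nm_set S, s <= n & p s].
Proof.
rewrite /cut -lock.
apply/imfsetP/idP => [[x /= + ->]|].
  rewrite !inE => /orP[/eqP->//|/andP[]].
  rewrite mem_nm_upto => -> ->.
  by rewrite (valP x) orbT.
case/orP => [/eqP->|/and3P[sS sn ps]]; first by exists point; rewrite ?inE ?eqxx.
exists (Sub s sS) => //=; rewrite !inE.
by apply/orP; right; rewrite mem_nm_upto SubK sn.
Qed.

(** This is {0, s} only for [s] in [S]; otherwise the cut leaves just {0}. *)
Definition pair0 s : P := cut (pred1 s) s.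

Lemma in_pair0 s k : s \in nm_set S -> (k \in elts (pair0 s)) = (k == 0) || (k == s).
Proof.
move=> sS; rewrite in_cut; case: eqP => //= _.
by case: eqP => [->|]; rewrite ?andbF // sS leqnn.
Qed.

Definition fmax A := \max_(a : elts A) val a.

Lemma leq_fmax A s : s \in elts A -> s <= fmax A.
Proof. by move=> sA; rewrite (leq_bigmax (FSetSub sA)). Qed.

Lemma fmax_in A : fmax A \in elts A.
Proof.
have card_gt0 : 0 < #|{: elts A}| by apply/card_gt0P; exists (FSetSub (elts0 A)).
by rewrite /fmax; case: (eq_bigmax val card_gt0) => a ->; exact: valP.
Qed.

Lemma fmax_eq A s : s \in elts A -> (forall k, k \in elts A -> k <= s) -> fmax A = s.
Proof. by move=> sA leAs; apply/eqP; rewrite eqn_leq leAs ?fmax_in ?leq_fmax. Qed.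

Lemma fmaxM A B : fmax (A * B) = fmax A + fmax B.
Proof.
apply: fmax_eq => [|_ /in_eltsM[a [b [aA bB ->]]]]; first by rewrite eltsM ?fmax_in.
by rewrite leq_add ?leq_fmax.
Qed.

Lemma fmaxX A k : fmax (A ^+ k) = (k * fmax A)%N.
Proof.
elim: k => [|k IHk]; last by rewrite expgS fmaxM IHk mulSn.
by apply: fmax_eq => [|s]; rewrite in_elts1 // => /eqP->.
Qed.

Lemma fmax_pair0 s : s \in nm_set S -> fmax (pair0 s) = s.
Proof.
move=> sS; apply: fmax_eq => [|k]; rewrite in_pair0 ?eqxx ?orbT //.
by case/orP => /eqP->.
Qed.

Lemma fmax_nm A : fmax A \in nm_set S.
Proof. exact/elts_nm/fmax_in. Qed.

Lemma elts_expP A k s :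
  reflect (exists2 l : seq nat, size l = k & {subset l <= elts A} /\ s = sumn l)
          (s \in elts (A ^+ k)).
Proof.
elim: k s => [|k IHk] s.
  rewrite in_elts1; apply: (iffP eqP) => [->|[[|//] _ [_ ->//]]].
  by exists [::].
rewrite expgS; apply: (iffP (in_eltsM _ _ _)).
  move=> [a [_ [aA /IHk[l sz_l [lA ->]] ->]]].
  exists (a :: l); rewrite /= ?sz_l //; split=> // b; rewrite inE.
  by case/orP => [/eqP->//|]; exact: lA.
case=> [[//|a l] [sz_l] [lA ->]]; exists a, (sumn l); split=> //.
  by apply: lA; rewrite mem_head.
by apply/IHk; exists l => //; split=> // b bl; apply: lA; rewrite inE bl orbT.
Qed.

(* Among [fmax A] elements of [A], two prefix sums agree modulo [fmax A]; the
   elements in between can be traded for copies of [0] and [fmax A]. *)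
Lemma expg_absorb A : exists k, A ^+ k.+1 = A ^+ k * pair0 (fmax A).
Proof.
set a := fmax A; have aA : a \in elts A := fmax_in A.
have aS : a \in nm_set S := fmax_nm A.
have [a0|a_gt0] := posnP a.
  exists 0; apply: eltsP => s; rewrite expg1 -[RHS]/(s \in elts (1 * _)) mul1g.
  rewrite in_pair0 // a0 orbb; apply/idP/eqP => [/leq_fmax|->]; last exact: elts0.
  by rewrite -/a a0 leqn0 => /eqP.
exists a.-1; apply: eltsP => s; apply/idP/idP; last first.
  case/in_eltsM => b [c [bA cP ->]]; rewrite expgSr eltsM //.
  by move: cP; rewrite in_pair0 // => /orP[]/eqP->; rewrite ?elts0.
rewrite prednK // => /elts_expP[l sz_l [lA ->]].
(* A word of length [a] has [a.+1] prefixes but only [a] residues, whence the choice [k = a.-1]. *)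
have: ~~ injectiveb (fun i : 'I_a.+1 => Ordinal (ltn_pmod (sumn (take i l)) a_gt0)).
  by apply/injectiveP => /leq_card; rewrite !card_ord ltnn.
case/injectivePn => i [j]; wlog lt_ij : i j / i < j.
  move=> wl ne_ij; case: (ltngtP i j) (ne_ij) => [lt|lt|/val_inj-> /eqP//] _.
    exact: wl ne_ij.
  by move=> /esym; apply: wl; rewrite // eq_sym.
move=> _ [] eq_mod.
have le_ja : j <= a by rewrite -ltnS.
set l1 := take i l; set l2 := drop i (take j l); set l3 := drop j l.
have l12 : take j l = l1 ++ l2 by rewrite -(cat_take_drop i (take j l)) take_takel // ltnW.
have lE : l = l1 ++ l2 ++ l3 by rewrite catA -l12 cat_take_drop.
have sz2 : size l2 = j - i by rewrite size_drop size_take_min sz_l; lia.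
have szE : size l1 + size l2 + size l3 = a by rewrite -sz_l [in RHS]lE !size_cat addnA.
have le_sum (r : seq nat) : {subset r <= elts A} -> sumn r <= size r * a.
  elim: r => //= b r IHr rA; rewrite mulSn leq_add ?IHr ?leq_fmax ?rA ?mem_head //.
  by move=> c cr; rewrite rA // inE cr orbT.
have l2A : {subset l2 <= elts A} by move=> b bl; apply: lA; rewrite lE !mem_cat bl orbT.
have /dvdnP[q q2] : a %| sumn l2.
  move/eqP: eq_mod; rewrite l12 sumn_cat -[X in X == _ %[mod a]]addn0 eqn_modDl.
  by rewrite mod0n eq_sym.
have q_le : q <= size l2 by rewrite -(leq_pmul2r a_gt0) -q2 le_sum.
(* It suffices to trade [l2] for a word one letter shorter and a summand [c] in {0, a}, keeping the
   sum. *)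
have H r c : size r = (size l2).-1 -> {subset r <= elts A} -> sumn l2 = sumn r + c ->
    c \in elts (pair0 a) -> sumn l \in elts (A ^+ a.-1 * pair0 a).
  move=> szr rA sumE cP; rewrite lE !sumn_cat sumE.
  have -> : sumn l1 + (sumn r + c + sumn l3) = sumn (l1 ++ r ++ l3) + c.
    by rewrite !sumn_cat; lia.
  apply: eltsM => //; apply/elts_expP; exists (l1 ++ r ++ l3).
    by rewrite !size_cat szr; lia.
  split=> // b; rewrite !mem_cat => /or3P[bl|/rA//|bl];
    by apply: lA; rewrite lE !mem_cat bl ?orbT.
(* The sum of [l2] is rebuilt from copies of [a] padded with zeros; one copy of [a], or a zero if
   there is none, serves as [c]. *)
case: q => [|q] in q2 q_le.
  apply: (H (nseq (size l2).-1 0) 0); rewrite ?size_nseq ?elts0 // ?sumn_nseq; try lia.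
  by move=> b /nseqP[-> _]; exact: elts0.
apply: (H (nseq q a ++ nseq (size l2 - q.+1) 0) a).
- by rewrite size_cat !size_nseq; lia.
- by move=> b; rewrite mem_cat => /orP[]/nseqP[-> _] //; exact: elts0.
- by rewrite sumn_cat !sumn_nseq; lia.
- by rewrite in_pair0 // eqxx orbT.
Qed.

End NaturalElements.

Arguments fmax {S} A.

(** * Automorphisms fix every {0, s} and preserve maxima *)

Section Automorphism.
Variable S : numerical_monoid.
Local Notation P := (Pfin (nm_sort S)).
Implicit Types (f : Aut_monoid P) (A B C : P) (s k n m c : nat).

Lemma aut1 f : f 1 = 1.
Proof. by case: (aut_morphism f). Qed.

Lemma autM f A B : f (A * B) = f A * f B.
Proof. by case: (aut_morphism f) => _; apply. Qed.

Lemma autX f A k : f (A ^+ k) = f A ^+ k.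
Proof. by elim: k => [|k IHk]; rewrite ?expg0 ?aut1 // !expgS autM IHk. Qed.

Lemma autVK f A : f^-1 (f A) = A.
Proof. exact: aut_funK. Qed.

Lemma autKV f A : f (f^-1 A) = A.
Proof. exact: aut_invK. Qed.

(** Apply [f] to the identity of [expg_absorb] and take maxima: the contribution of [f A ^+ k]
    cancels. *)
Lemma fmax_aut f A : fmax (f A) = fmax (f (pair0 S (fmax A))).
Proof.
have [k /(congr1 (fmax \o f))] := expg_absorb A.
by rewrite /= expgSr !autM !fmaxM => /addnI.
Qed.

(** Absorption for [B], pulled back along [f^-1], puts [C], the preimage of {0, max B}, inside a
    power of {0, s} and gives it maximum [s]. Its elements are multiples of [s], so [C] is {0,
    s}. *)
Lemma aut_pair0 f s : s \in nm_set S -> f (pair0 S s) = pair0 S (fmax (f (pair0 S s))).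
Proof.
move=> sS; set B := f _; have [k /(congr1 f^-1)] := expg_absorb B.
rewrite autM !autX autVK => sE; rewrite -[RHS](autKV f) -/B; congr (f _).
set C := f^-1 _ in sE *; have Cmax : fmax C = s.
  have := congr1 fmax sE.
  by rewrite fmaxM !fmaxX fmax_pair0 // mulSn addnC => /addnI.
apply: eltsP => c; rewrite in_pair0 //; apply/orP/idP => [[/eqP->|/eqP->]|cC].
- exact: elts0.
- by rewrite -Cmax fmax_in.
have: c \in elts (pair0 S s ^+ k.+1) by rewrite sE eltsMr.
case/elts_expP => l _ [ls cE]; have: s %| c.
  rewrite {}cE; elim: l ls => //= a l IHl als; rewrite dvdn_add ?IHl //.
    have := als a (mem_head _ _); rewrite in_pair0 //.
    by case/orP => /eqP->.
  by move=> b bl; rewrite als // inE bl orbT.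
have := leq_fmax cC; rewrite Cmax => le_cs /dvdnP[q cq].
case: q cq => [->|[|q] cq]; first by left.
  by right; rewrite cq mul1n.
by case: (posnP s) => [s0|s0]; [left|]; nia.
Qed.

Lemma nm_bound : exists2 K, 0 < K & forall s, K <= s -> s \in nm_set S.
Proof.
have /finite_seqP[r rE] := nm_cofinite S.
exists (\max_(s <- r) s).+1 => // s gt_s; apply/contraT => sNS.
have : s \in r by have : [set` r] s; [rewrite -rE => /= sS; rewrite mem_set in sNS|].
by move=> sr; move: gt_s; rewrite ltnNge (leq_bigmax_seq s).
Qed.

Lemma nmD s k : s \in nm_set S -> k \in nm_set S -> s + k \in nm_set S.
Proof. by rewrite !inE; exact: nm_setD. Qed.

Lemma nm0 : 0 \in nm_set S.
Proof. by rewrite inE; exact: nm_set0. Qed.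

Lemma nmM k s : s \in nm_set S -> (k * s)%N \in nm_set S.
Proof. by move=> sS; elim: k => [|k IHk]; rewrite ?nm0 // mulSn nmD. Qed.

(** The induced map [phi] on [S] is additive, so [s * phi K = K * phi s]. Comparing the consecutive
    elements [K] and [K.+1] of [S] shows that the slope is a natural number. *)
Lemma fmax_aut_scale f :
  exists c, forall s, s \in nm_set S -> fmax (f (pair0 S s)) = (c * s)%N.
Proof.
pose phi s := fmax (f (pair0 S s)).
have phiD s k : s \in nm_set S -> k \in nm_set S -> phi (s + k) = phi s + phi k.
  move=> sS kS; rewrite /phi -fmaxM -autM [RHS]fmax_aut fmaxM.
  by rewrite !fmax_pair0.
have phi0 : phi 0 = 0 by have := phiD 0 0 nm0 nm0; rewrite addn0; lia.
have phiM k s : s \in nm_set S -> phi (k * s)%N = (k * phi s)%N.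
  move=> sS; elim: k => [|k IHk]; first by rewrite !mul0n.
  by rewrite !mulSn phiD ?nmM // IHk.
have [K K_gt0 geK] := nm_bound.
have KE : (K.+1 * phi K)%N = (K * phi K.+1)%N.
  by rewrite -!phiM ?geK // mulnC.
exists (phi K.+1 - phi K) => s sS; rewrite -/(phi s).
apply/eqP; rewrite -(eqn_pmul2l K_gt0) -phiM // mulnC phiM ?geK //.
apply/eqP; have: (K * (phi K.+1 - phi K))%N = phi K by rewrite mulnBr -KE mulSn addnK.
by move=> {1}<-; rewrite mulnCA [(s * _)%N]mulnC.
Qed.

(** The scale factors of [f] and [f^-1] are naturals with product 1. *)
Lemma aut_pair0_id f s : s \in nm_set S -> f (pair0 S s) = pair0 S s.
Proof.
have [c fc] := fmax_aut_scale f; have [d fd] := fmax_aut_scale f^-1.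
have [K K_gt0 geK] := nm_bound; have KS : K \in nm_set S by exact: geK.
suff c1 : c = 1%N by move=> sS; rewrite aut_pair0 // fc // c1 mul1n.
have cKS : (c * K)%N \in nm_set S by rewrite -fc // fmax_nm.
have := fd _ cKS; rewrite -fc // -aut_pair0 // autVK fmax_pair0 // fc //.
rewrite mulnA -{1}[K]mul1n => /eqP; rewrite eqn_pmul2r // eq_sym muln_eq1.
by case/andP => _ /eqP.
Qed.

Lemma fmax_aut_id f A : fmax (f A) = fmax A.
Proof. by rewrite fmax_aut aut_pair0_id ?fmax_pair0 ?fmax_nm. Qed.

Lemma fmax_aut_in f A : fmax A \in elts (f A).
Proof. by rewrite -(fmax_aut_id f) fmax_in. Qed.

End Automorphism.

(** * Tails of [S] above a fixed [x], and their images under automorphisms *)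

Section Tails.
Variables (S : numerical_monoid) (x K : nat).
Hypotheses (x_lt_K : x < K) (geK : forall s, K <= s -> s \in nm_set S).
Local Notation P := (Pfin (nm_sort S)).
Implicit Types (f : Aut_monoid P) (A B C : P) (s k n m c : nat).

Definition tail n : P := cut S (ltn x) n.

Lemma in_tail n s :
  (s \in elts (tail n)) = (s == 0) || [&& s \in nm_set S, s <= n & x < s].
Proof. exact: in_cut. Qed.

Lemma fmax_tail n : K <= n -> fmax (tail n) = n.
Proof.
move=> le_Kn; apply: fmax_eq => [|k]; rewrite in_tail.
  by rewrite geK // leqnn (leq_trans x_lt_K) ?orbT.
by case/orP => [/eqP->//|/and3P[]].
Qed.

(** An element [s > n] is written [(s - c) + c]; the bound on [n] makes [s - c] at least [K], hence
    in [S] and above [x]. *)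
Lemma tail_pair0 n c : c \in nm_set S -> x < c -> c + K <= n ->
  tail n * pair0 S c = tail (n + c).
Proof.
move=> cS lt_xc le_cKn; apply: eltsP => s; apply/in_eltsM/idP.
  move=> [a [b [+ + ->]]]; rewrite !in_tail in_pair0 //.
  case/orP => [/eqP->|/and3P[aS le_an lt_xa]] /orP[]/eqP->.
  - by [].
  - by rewrite cS lt_xc; lia.
  - by rewrite addn0 aS lt_xa; lia.
  - by rewrite nmD //; lia.
rewrite in_tail => /orP[/eqP->|/and3P[sS le_snc lt_xs]].
  by exists 0, 0; rewrite !elts0.
have [le_sn|lt_ns] := leqP s n.
  by exists s, 0; rewrite elts0 addn0 in_tail sS le_sn lt_xs orbT.
exists (s - c), c; rewrite in_tail in_pair0 // eqxx orbT geK; last by lia.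
by split=> //; lia.
Qed.

Lemma tailM n m : 2 * K <= n -> 2 * K <= m -> tail n * tail m = tail (n + m).
Proof.
move=> le_n le_m; apply: eltsP => s; apply/in_eltsM/idP.
  move=> [a [b [+ + ->]]]; rewrite !in_tail.
  case/orP => [/eqP->|/and3P[aS le_an lt_xa]].
    case/orP => [/eqP->//|/and3P[bS le_bm lt_xb]].
    by rewrite add0n bS lt_xb; lia.
  case/orP => [/eqP->|/and3P[bS le_bm lt_xb]].
    by rewrite addn0 aS lt_xa; lia.
  by rewrite nmD //; lia.
rewrite in_tail => /orP[/eqP->|/and3P[sS le_snc lt_xs]].
  by exists 0, 0; rewrite !elts0.
have [le_sn|lt_ns] := leqP s n.
  by exists s, 0; rewrite elts0 addn0 in_tail sS le_sn lt_xs orbT.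
(* A difference [s - n] below [K] may fall outside [S], so [s] is then split as [(s - K) + K]. *)
have [lt_snK|le_Ksn] := ltnP (s - n) K.
  by exists (s - K), K; rewrite !in_tail !geK; try lia; split=> //; lia.
by exists n, (s - n); rewrite !in_tail !geK; try lia; split=> //; lia.
Qed.

Lemma tailX n k : 2 * K <= n -> tail n ^+ k.+1 = tail (k.+1 * n)%N.
Proof.
move=> le_n; elim: k => [|k IHk]; first by rewrite expg1 mul1n.
by rewrite expgS IHk tailM ?mulSn //; lia.
Qed.

(** Add [j] copies of [a] to [k - j] copies of [a.+1]. *)
Lemma elts_expX A a k j : a.+1 \in elts A -> a \in elts A -> j <= k ->
  (k * a.+1 - j)%N \in elts (A ^+ k).
Proof.
move=> a1A aA; elim: k j => [|k IHk] [|j] // le_jk; rewrite ?elts0 // expgS.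
  by rewrite subn0 mulSn eltsM // -[(k * _)%N]subn0 IHk.
have -> : (k.+1 * a.+1 - j.+1 = a + (k * a.+1 - j))%N by nia.
by rewrite eltsM ?IHk.
Qed.

(** By [tail_pair0] a factor {0, s}, fixed by [f], splits off [tail m] when [s < 2 * K]. For larger
    [s] a factor {0, K} splits off and induction applies to [s - K]. *)
Lemma low_aut_tail f s m : s \in nm_set S -> x < s -> s + 4 * K <= m ->
  s \in elts (f (tail m)).
Proof.
elim/ltn_ind: s m => s IHs m sS lt_xs le_sm.
have [lt_s2K|le_2Ks] := ltnP s (2 * K).
  rewrite -[m](@subnK s); last by lia.
  rewrite -tail_pair0 //; last by lia.
  by rewrite autM eltsMr // aut_pair0_id // in_pair0 // eqxx orbT.
have KS : K \in nm_set S by exact: geK.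
rewrite -[m](@subnK K); last by lia.
rewrite -tail_pair0 //; last by lia.
rewrite autM -[s](@subnK K); last by lia.
apply: eltsM; first by apply: IHs; rewrite ?geK; lia.
by rewrite aut_pair0_id // in_pair0 // eqxx orbT.
Qed.

Hypothesis notin1 : 1%N \notin nm_set S.

(** Take the sum of the sets {0, s} over the positive [s <= x] in [S]: each summand is fixed by [f]
    and symmetric, and sums inherit both properties. *)
Lemma symmetric_cover : exists A, [/\ forall f, f A = A,
  forall s, s \in nm_set S -> s <= x -> s \in elts A &
  forall s, s \in elts A -> fmax A - s \in elts A].
Proof.
elim: x => [|y [A [fA coverA symA]]].
  exists 1; split=> [f|s _|s]; rewrite ?aut1 ?leqn0 ?in_elts1 //.
  move=> /eqP->; rewrite subn0 -[fmax 1]/(fmax (1 ^+ 0)) fmaxX mul0n; exact: eqxx.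
have [yS|yNS] := boolP (y.+1 \in nm_set S); last first.
  exists A; split=> // s sS; rewrite leq_eqVlt => /orP[/eqP sE|].
    by rewrite -sE sS in yNS.
  exact: coverA.
exists (A * pair0 S y.+1); split=> [f|s sS|s].
- by rewrite autM fA aut_pair0_id.
- rewrite leq_eqVlt => /orP[/eqP->|lt_sy].
    by rewrite eltsMr // in_pair0 // eqxx orbT.
  by rewrite eltsMl ?coverA.
- case/in_eltsM => a [b [aA bP ->]]; have le_a := leq_fmax aA.
  rewrite fmaxM fmax_pair0 //; move: bP; rewrite in_pair0 // => /orP[]/eqP->.
    rewrite addn0 -addnBAC // eltsM ?symA //.
    by rewrite in_pair0 // eqxx orbT.
  by rewrite subnDr eltsMl ?symA.
Qed.

(* The cover [A] completes [tail n] to an initial segment of [S], which absorbs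
   any [B] as if it were [{0, max B}].  Taking for [B] the preimage of
   [{0, K, K + 1}] produces the element [n + max A + K] of the image; since
   [max A - 1] is not in [A], it can only come from [n - 1]. *)
Lemma pred_aut_tail f : exists n0, forall n, n0 <= n -> n.-1 \in elts (f (tail n)).
Proof.
have [A [fA coverA symA]] := symmetric_cover.
set m := fmax A; have mS : m \in nm_set S := fmax_nm A.
have KS : K \in nm_set S by exact: geK.
have K1S : K.+1 \in nm_set S by rewrite geK.
pose D := cut S (fun s => K <= s) K.+1; pose B := f^-1 D.
have inD s : (s \in elts D) = [|| s == 0, s == K | s == K.+1].
  rewrite in_cut; case: eqP => //= s0; apply/and3P/orP => [[sS le_s le_Ks]|].
    by apply/orP; lia.
  by case=> /eqP->; split.
have maxB : fmax B = K.+1.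
  rewrite fmax_aut_id; apply: fmax_eq => [|k]; rewrite inD ?eqxx ?orbT //.
  by case/or3P => /eqP->.
exists (m + 3 * K)%N => n le_n.
have fill s : s \in nm_set S -> s <= n + m -> s \in elts (tail n * A).
  move=> sS le_s; have [le_sx|lt_xs] := leqP s x; first by rewrite eltsMr ?coverA.
  have [le_sn|lt_ns] := leqP s n; first by rewrite eltsMl // in_tail sS le_sn lt_xs orbT.
  rewrite -[s](@subnK m) ?eltsM ?fmax_in // ?in_tail; last by lia.
  by rewrite geK; lia.
have absorb : tail n * A * B = tail n * A * pair0 S K.+1.
  apply: eltsP => s; apply/idP/idP => [sB|].
    have sS := elts_nm sB; have := leq_fmax sB.
    rewrite !fmaxM fmax_tail ?maxB -/m; last by lia.
    have [le_s _|lt_s le_s] := leqP s (n + m); first by rewrite eltsMl ?fill.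
    rewrite -[s](@subnK K.+1); last by lia.
    apply: eltsM; last by rewrite in_pair0 // eqxx orbT.
    by apply: fill; rewrite ?geK; lia.
  case/in_eltsM => a [b [aA + ->]]; rewrite in_pair0 // => /orP[]/eqP->.
    by rewrite addn0 eltsMl.
  by rewrite eltsM // -maxB fmax_in.
have := congr1 f absorb; rewrite !autM fA autKV aut_pair0_id // => eqD.
have nE : n \in elts (f (tail n)).
  by have := fmax_aut_in f (tail n); rewrite fmax_tail //; lia.
have: n + m + K \in elts (f (tail n) * A * D).
  by rewrite !eltsM ?fmax_in // inD eqxx orbT.
rewrite eqD => /in_eltsM[_ [b [/in_eltsM[v [a [vV aA ->]]]]]].
have := leq_fmax aA; have := leq_fmax vV.
rewrite fmax_aut_id fmax_tail -/m; last by lia.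
(* [b = 0] is impossible because [v + a <= n + m] and [K > 0]; [b = K.+1] leaves
   [v + a = n + m - 1]. *)
move=> le_vn le_am; rewrite in_pair0 // => /orP[]/eqP-> eq_nmK; first by lia.
have [v_pred|v_n] : v = n.-1 \/ v = n by lia.
  by rewrite -v_pred.
have a_pred : m - a = 1%N by lia.
by have := elts_nm (symA _ aA); rewrite -/m a_pred (negPf notin1).
Qed.

Lemma tail_sub_aut f c0 : exists c, [/\ c0 <= c, 2 * K <= c, x < c &
  {subset elts (tail c) <= elts (f (tail c))}].
Proof.
have [n0 predV] := pred_aut_tail f.
(* With [c = 4 * K * n], [f (tail c)] is the [4 * K]-th power of [f (tail n)], which contains [n.-1]
   and [n]; this covers the top [4 * K] values, and [low_aut_tail] covers the rest. *)
pose n := (n0 + c0 + 2 * K).+1; exists (4 * K * n)%N.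
have Vn1 : n.-1 \in elts (f (tail n)) by apply: predV; lia.
have Vn : n \in elts (f (tail n)).
  by have := fmax_aut_in f (tail n); rewrite fmax_tail //; lia.
split; try nia.
move=> s; rewrite in_tail => /orP[/eqP->|]; first exact: elts0.
case/and3P => sS le_sc lt_xs.
have [le_s|lt_s] := leqP (s + 4 * K) (4 * K * n); first exact: low_aut_tail.
rewrite -[(4 * K)%N]prednK; last by lia.
rewrite -tailX ?autX ?prednK; try lia.
by rewrite -(subKn le_sc); apply: elts_expX => //; lia.
Qed.

(* For [g] the inverse of [f], [g (tail c)] contains [tail c], so [tail c] acts
   on [g (tail n)] as [{0, c}] does; now apply [f]. *)
Lemma aut_tail_clean f c0 : exists2 c, c0 <= c &
  forall s, s \in elts (f (tail c)) -> s <= x -> s = 0.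
Proof.
have [c [le_c0c le_2Kc lt_xc subV]] := tail_sub_aut f^-1 c0; exists c => //.
have cS : c \in nm_set S by rewrite geK //; lia.
pose g := f^-1; pose n := (c + 2 * K)%N.
have absorb : g (tail n) * tail c = g (tail n) * pair0 S c.
  apply: eltsP => s; apply/idP/idP => /in_eltsM[a [b [aV bT ->]]].
    rewrite -[pair0 S c](aut_pair0_id g) // -autM tail_pair0 //; last by lia.
    rewrite -tailM //; last by lia.
    by rewrite autM eltsM ?subV.
  rewrite eltsM //; move: bT; rewrite in_pair0 // => /orP[]/eqP->; first exact: elts0.
  by rewrite in_tail cS leqnn lt_xc orbT.
(* After applying [f], the right side is [tail n * pair0 S c], which has no element in ]0,x]. *)
move=> s sU le_sx; have := congr1 f absorb; rewrite !autM !autKV aut_pair0_id // => eqU.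
have: s \in elts (tail n * f (tail c)) by rewrite eltsMr.
rewrite eqU => /in_eltsM[a [b [+ + sE]]].
by rewrite in_tail in_pair0 // => /orP[/eqP a0|/and3P[_ _ lt_xa]] /orP[]/eqP b0; lia.
Qed.

(** Only one direction of the criterion is transported: applying [f] to [absorb] writes [x] as
    [a + t] with [a] in [f A] and [t] in [f (tail c)], and cleanness of that tail forces [t = 0]. *)
Lemma mem_aut f A : x \in elts A -> x \in elts (f A).
Proof.
move=> xA; have [->|x_gt0] := posnP x; first exact: elts0.
have xS := elts_nm xA.
have [c le_c clean] := aut_tail_clean f (fmax A + 3 * K).
pose n := (c - x)%N.
have absorb : A * pair0 S x * tail n = A * tail c.
  apply: eltsP => s; apply/idP/idP; last first.
    case/in_eltsM => a [t [aA + ->]]; rewrite in_tail => tT.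
    have [le_tn|lt_nt] := leqP t n.
      rewrite eltsM ?eltsMl // in_tail.
      by case/orP: tT => [->//|/and3P[-> _ ->]]; rewrite le_tn orbT.
    have -> : a + t = a + x + (t - x) by lia.
    apply: eltsM; first by rewrite eltsM // in_pair0 // eqxx orbT.
    by rewrite in_tail geK; lia.
  case/in_eltsM => _ [t [/in_eltsM[a [p [aA + ->]]] + ->]].
  have aS := elts_nm aA; have le_a := leq_fmax aA.
  rewrite in_pair0 // in_tail => /orP[]/eqP->.
    move=> tT; rewrite addn0 eltsM // in_tail.
    by case/orP: tT => [->//|/and3P[-> le_tn ->]]; apply/orP; right; lia.
  case/orP => [/eqP->|/and3P[tS le_tn lt_xt]].
    (* The sum [a + x] is [x] itself, an element of [A], when [a = 0]; otherwise it exceeds [x] and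
       lies in [tail c]. *)
    rewrite addn0; have [->|a_gt0] := posnP a; first by rewrite add0n eltsMl.
    by rewrite eltsMr // in_tail nmD //; lia.
  by rewrite -addnA eltsM // in_tail nmD //; lia.
have := congr1 f absorb; rewrite !autM aut_pair0_id // => eqf.
have: x \in elts (f A * pair0 S x * f (tail n)).
  by rewrite eltsMl // eltsMr // in_pair0 // eqxx orbT.
rewrite eqf => /in_eltsM[a [t [aA tT xE]]].
by rewrite xE (clean t tT) ?addn0 //; lia.
Qed.

End Tails.

(** * Triviality for the power monoid, and transfer to the Hom-monoid *)

Section Rigidity.
Variable S : numerical_monoid.
Hypothesis S_proper : nm_set S `<` [set: nat].

Lemma proper_notin1 : 1%N \notin nm_set S.
Proof.
apply/negP => S1; case: S_proper => _; apply => n _.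
have := nmM n S1; rewrite muln1; exact: set_mem.
Qed.

(** Every automorphism can only enlarge sets; applying this to [f^-1] at [f A] gives the reverse
    inclusion. *)
Lemma Pfin_aut_id (f : Aut_monoid (Pfin (nm_sort S))) : f =1 id.
Proof.
have sub (h : Aut_monoid (Pfin (nm_sort S))) A : {subset elts A <= elts (h A)}.
  move=> x; have [K _ geK] := nm_bound S.
  (* The threshold is raised so that it also exceeds [x]. *)
  apply: (@mem_aut S x (K + x.+1)); rewrite ?proper_notin1 //; first by lia.
  by move=> s le_s; apply: geK; lia.
move=> A; apply: eltsP => s; apply/idP/idP; last exact: sub.
by rewrite -{2}(autVK f A); exact: sub.
Qed.

Local Notation Hom := (Kl_hom 'Z_2 (nm_sort S)).
Local Notation P := (Pfin (nm_sort S)).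

Definition Hom_of_Pfin_fun (A : P) (i : 'Z_2) : P := if i == ord0 then point else A.

Definition Hom_of_Pfin (A : P) : Hom :=
  @PtdMap 'Z_2 P (Hom_of_Pfin_fun A) erefl.

Definition Pfin_of_Hom (u : Hom) : P := u (@ord_max 1).

Lemma Pfin_of_HomK : cancel Pfin_of_Hom Hom_of_Pfin.
Proof.
move=> u; apply: ptd_mapP => i /=; rewrite /Hom_of_Pfin_fun.
case: eqP => [->|i0]; first by rewrite -(ptd_fun_point u).
rewrite /Pfin_of_Hom; congr (u _); apply: val_inj.
by case: i i0 => [[|[|//]] ilt] //= i0; case: i0; apply: val_inj.
Qed.

Lemma Hom_of_PfinM (A B : P) : Hom_of_Pfin (A * B) = Hom_of_Pfin A * Hom_of_Pfin B.
Proof. by apply: (can_inj Pfin_of_HomK). Qed.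

Section Transfer.
Variable F : Aut_monoid Hom.

Lemma Pfin_aut_morphism :
  monoid.monoid_morphism (Pfin_of_Hom \o F \o Hom_of_Pfin).
Proof.
case: (aut_morphism F) => F1 FM; split=> [|A B] /=.
  have -> : Hom_of_Pfin 1 = 1 by exact: (can_inj Pfin_of_HomK).
  by rewrite F1.
by rewrite Hom_of_PfinM FM.
Qed.

Lemma Pfin_aut_funK :
  cancel (Pfin_of_Hom \o F \o Hom_of_Pfin) (Pfin_of_Hom \o aut_inv F \o Hom_of_Pfin).
Proof. by move=> A; rewrite /= Pfin_of_HomK aut_funK. Qed.

Lemma Pfin_aut_invK :
  cancel (Pfin_of_Hom \o aut_inv F \o Hom_of_Pfin) (Pfin_of_Hom \o F \o Hom_of_Pfin).
Proof. by move=> A; rewrite /= Pfin_of_HomK aut_invK. Qed.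

Definition Pfin_aut : Aut_monoid P :=
  AutMonoid Pfin_aut_morphism Pfin_aut_funK Pfin_aut_invK.

(** [F] is conjugate to [Pfin_aut] by evaluation, which is injective. *)
Lemma Hom_aut_id : F =1 id.
Proof.
move=> u; apply: (can_inj Pfin_of_HomK); rewrite -[u in F u]Pfin_of_HomK.
exact: (Pfin_aut_id Pfin_aut).
Qed.

End Transfer.
End Rigidity.

Theorem theorem5p9 (S : numerical_monoid) (S_proper : nm_set S `<` [set: nat]) :
  group_isomorphic (Aut_monoid (Kl_hom 'Z_2 (nm_sort S))) unit.
Proof.
exists (one_fun unit : {multiplicative _ -> _}).
exists (fun=> 1) => [F|[]//]; apply: Aut_monoidP => u.
by rewrite (Hom_aut_id S_proper F).
Qed.
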